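(* For every fixed positive integer $t$: if $t\le5$ then $B_{\mathcal{F}_t}=O(n^{2t-1})$, and if $t>5$ then $B_{\mathcal{F}_t}=O(n^{10}\log^2 n)$.
   Context: Identify $\{0,1\}$ with $\mathbb{F}_2$. $\ell(x)=\sum_k x_k$ (real sum). For distinct $i,j\in\{1,\dots,n\}$, the elementary transvection $\tau_{ij}:\mathbb{F}_2^n\to\mathbb{F}_2^n$ is the linear map with $(\tau_{ij}x)_i=x_i+x_j$ (mod 2) and other coordinates unchanged. $G_t$ is the set of all products of $t$ elementary transvections (repetitions allowed), and $\mathcal{F}_t=\{x\mapsto\ell(Mx+b): M\in G_t,\ b\in\mathbb{F}_2^n\}$ (computed over $\mathbb{F}_2$). For a class $\mathcal{C}$ of functions $\{0,1\}^n\to\mathbb{R}$, $B_{\mathcal{C}}=\inf_A\sup_{f\in\mathcal{C}}\mathbb{E}(T(A,f))$, where $A$ ranges over randomized black-box search algorithms and $T(A,f)$ is the number of evaluations until a global maximizer of $f$ is evaluated for the first time. *)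

(* Defs.v *)
From HB Require Import structures.
From mathcomp Require Import all_boot all_order all_algebra.
From mathcomp Require Import reals exp.
Set Implicit Arguments. Unset Strict Implicit. Unset Printing Implicit Defensive.
Import Order.TTheory GRing.Theory Num.Theory.
Local Open Scope ring_scope.

Definition bv (n : nat) := {ffun 'I_n -> bool}.

Definition ell n (x : bv n) : nat := (\sum_(k < n) (x k : nat))%N.

Definition bvadd n (x y : bv n) : bv n := [ffun k => x k (+) y k].

Definition transvection n (i j : 'I_n) (x : bv n) : bv n :=
  [ffun k => if k == i then x i (+) x j else x k].

Definition prod_transv n (s : seq ('I_n * 'I_n)) : bv n -> bv n :=
  foldr (fun p g => transvection p.1 p.2 \o g) id s.

Definition in_G n (t : nat) (M : bv n -> bv n) : Prop :=
  exists s : seq ('I_n * 'I_n),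
    [/\ size s = t, all (fun p => p.1 != p.2) s & M =1 prod_transv s].

Definition in_F (R : realType) n (t : nat) (f : bv n -> R) : Prop :=
  exists (M : bv n -> bv n) (b : bv n),
    in_G t M /\ forall x, f x = (ell (bvadd (M x) b))%:R.

(* A randomized black-box search algorithm: given the history of queried
   points and their f-values (oldest first), a probability distribution on the
   next query point.  (Behavioural-strategy model of randomized algorithms.) *)
Record bb_algorithm (R : realType) (n : nat) := BBAlg {
  query : seq (bv n * R) -> bv n -> R;
  query_ge0 : forall h x, 0 <= query h x;
  query_sum1 : forall h, \sum_(x : bv n) query h x = 1 }.

Definition is_maximizer (R : realType) n (f : bv n -> R) (x : bv n) : bool :=
  [forall y, f y <= f x].

(* avoid A f k h = probability that, starting from history h, the next k
   queries of A on f all miss every global maximizer of f. *)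
Fixpoint avoid (R : realType) n (A : bb_algorithm R n) (f : bv n -> R)
    (k : nat) (h : seq (bv n * R)) : R :=
  match k with
  | 0 => 1
  | k'.+1 => \sum_(x : bv n | ~~ is_maximizer f x)
               query A h x * avoid A f k' (rcons h (x, f x))
  end.

(* E(T(A,f)) <= b, where T is the number of evaluations until a global
   maximizer is evaluated for the first time:
   E(T) = sum_{k>=0} P(T > k) = sum_{k >= 0} avoid A f k [::]. *)
Definition expected_runtime_le (R : realType) n (A : bb_algorithm R n)
    (f : bv n -> R) (b : R) : Prop :=
  forall K : nat, \sum_(k < K) avoid A f k [::] <= b.

Definition bound_t (R : realType) (t n : nat) : R :=
  if (t <= 5)%N then (n%:R) ^+ (2 * t - 1)
  else (n%:R) ^+ 10 * (ln (n%:R)) ^+ 2.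

(* Main.v *)
Require Import Defs.
From HB Require Import structures.
From mathcomp Require Import all_boot all_order all_algebra.
From mathcomp Require Import reals exp.
From mathcomp Require Import sequences zify.
Set Implicit Arguments. Unset Strict Implicit. Unset Printing Implicit Defensive.
Import Order.TTheory GRing.Theory Num.Theory.
Local Open Scope ring_scope.

(** A product of [t] transvections only involves a set [J] of at most [2t]
    coordinates; flipping any other coordinate [k] changes [ell (M x + b)] by
    [+1] or [-1] according to [x k (+) b k].  Hence two distinct functions of the
    class differ on a fraction at least [2^-(4t)] of the cube: either their
    offsets differ at some coordinate outside both sets [J], and then every flip
    of that coordinate destroys an agreement, or their difference depends on at
    most [4t] coordinates only.  As the class has [2^O(n)] elements, a greedy
    averaging argument gives [O(n)] fixed query points whose values determine
    the function, and one more query evaluates a maximizer.  The resulting bound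
    [O(n)] is stronger than the one claimed. *)

(** * Greedy choice of separating points *)

Lemma leq_expn2r m n e : (m <= n)%N -> (m ^ e <= n ^ e)%N.
Proof. by case: e => [//|e] le_mn; rewrite leq_exp2r. Qed.

(** The first two binomial terms of [((K - 1) + 1) ^ K] are each at least [(K - 1) ^ K]. *)
Lemma bernoulli_halving K : (0 < K)%N -> (2 * K.-1 ^ K <= K ^ K)%N.
Proof.
case: K => [//|K] _ /=; have -> : (K.+1 ^ K.+1 = (K + 1) ^ K.+1)%N by rewrite addn1.
rewrite expnDn big_ord_recl big_ord_recl /= !exp1n !muln1 bin0 bin1 subn0 subn1 /=.
by rewrite mul1n addnA (leq_trans _ (leq_addr _ _)) // mul2n -addnn leq_add2l expnS leq_mul.
Qed.

Section Separation.
Variables (P X : finType) (T : eqType) (F : P -> X -> T).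

Definition undistinguished (xs : seq X) : {set P * P} :=
  [set pq | [exists x, F pq.1 x != F pq.2 x]
            && all (fun x => F pq.1 x == F pq.2 x) xs].

Definition disagreement p q : {set X} := [set x | F p x != F q x].

Variable K : nat.
Hypothesis many_disagreements :
  forall p q x, F p x != F q x -> (#|X| <= K * #|disagreement p q|)%N.

(** Averaging: if every point separated less than a fraction [1/K] of the remaining pairs, double
    counting the incidences of points and separated pairs would contradict [many_disagreements]. *)
Lemma greedy_point (xs : seq X) (x0 : X) :
  exists x, (#|undistinguished xs|
    <= K * #|[set pq in undistinguished xs | F pq.1 x != F pq.2 x]|)%N.
Proof.
apply/existsP; apply: contraT; rewrite negb_exists => /forallP few.
set U := undistinguished xs in few *.
pose a x := #|[set pq in U | F pq.1 x != F pq.2 x]|.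
(* The term at [x0] is split off because strictness of the sum needs a nonempty [X]. *)
have lt_avg : (K * \sum_x a x < #|X| * #|U|)%N.
  rewrite big_distrr /= -sum_nat_const (bigD1 x0) //= [X in (_ < X)%N](bigD1 x0) //=.
  rewrite -addSn leq_add //; first by rewrite ltnNge few.
  by apply: leq_sum => x _; apply: ltnW; rewrite ltnNge few.
suff : (#|X| * #|U| <= K * \sum_x a x)%N by rewrite leqNgt lt_avg.
have -> : (\sum_x a x = \sum_(pq in U) #|disagreement pq.1 pq.2|)%N.
  under eq_bigr => x _ do rewrite /a cardsE -sum1_card.
  under [RHS]eq_bigr => pq _ do rewrite cardsE -sum1_card.
  under eq_bigr => x _ do rewrite big_mkcondr.
  under [RHS]eq_bigr => pq _ do rewrite big_mkcond.
  by rewrite exchange_big.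
rewrite mulnC -sum_nat_const big_distrr /=; apply: leq_sum => pq.
by rewrite inE => /andP[/existsP[x Fx] _]; apply: many_disagreements Fx.
Qed.

(** Each greedy point leaves at most a fraction [(K - 1)/K] of the pairs; denominators are cleared
    to stay in the naturals. *)
Lemma greedy_points (x0 : X) m : exists2 xs : seq X, size xs = m &
  (#|undistinguished xs| * K ^ m <= #|P| ^ 2 * K.-1 ^ m)%N.
Proof.
elim: m => [|m [xs sz_xs IH]].
  by exists [::] => //; rewrite !muln1 -mulnn -card_prod max_card.
have [x le_x] := greedy_point xs x0.
exists (x :: xs); first by rewrite /= sz_xs.
set U := undistinguished xs in IH le_x.
set V := [set _ in U | _] in le_x.
have -> : undistinguished (x :: xs) = U :\: V.
  apply/setP => pq; rewrite !inE /=.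
  by case: existsP => //= _; case: (F _ x == _); case: (all _ _).
have sVU : V \subset U by apply/subsetP => pq; rewrite inE => /andP[].
have cU := cardsID V U; rewrite (setIidPr sVU) in cU.
have step : (#|U :\: V| * K <= #|U| * K.-1)%N by nia.
rewrite (expnS K) (expnS K.-1) mulnA (leq_trans (leq_mul step (leqnn _))) //.
by rewrite mulnAC (mulnC K.-1) mulnA leq_mul.
Qed.

(** Every [K] greedy points at least halve the undistinguished pairs, so [K * L] of them leave fewer
    than one. *)
Lemma separating_points (x0 : X) L : (0 < K)%N -> (#|P| ^ 2 < 2 ^ L)%N ->
  exists2 xs : seq X, size xs = (K * L)%N &
    forall p q, {in xs, F p =1 F q} -> F p =1 F q.
Proof.
move=> K_gt0 ltPL; have [xs sz_xs le_xs] := greedy_points x0 (K * L).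
exists xs => // p q eq_xs x; apply/eqP; apply: contraT => neq_x.
have : (0 < #|undistinguished xs|)%N.
  rewrite card_gt0; apply/set0Pn; exists (p, q); rewrite inE /=.
  apply/andP; split; first by apply/existsP; exists x.
  by apply/allP => y /eq_xs /eqP.
move=> U_gt0; have KL_gt0 : (0 < K ^ (K * L))%N by rewrite expn_gt0 K_gt0.
have pow_le : (2 ^ L * K.-1 ^ (K * L) <= K ^ (K * L))%N.
  by rewrite !expnM -expnMn leq_expn2r ?bernoulli_halving.
have A_le : (K ^ (K * L) <= #|P| ^ 2 * K.-1 ^ (K * L))%N.
  exact: leq_trans (leq_pmull _ U_gt0) le_xs.
have B_gt0 : (0 < K.-1 ^ (K * L))%N.
  by rewrite lt0n; apply: contraTneq A_le => ->; rewrite muln0 -ltnNge.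
have := leq_trans pow_le A_le.
by rewrite leq_pmul2r // leqNgt ltPL.
Qed.

End Separation.

(** * Effect of a coordinate flip on the class *)

Definition unit_bv n (k : 'I_n) : bv n := [ffun i => i == k].

Lemma bvaddAC n (x y z : bv n) : bvadd (bvadd x y) z = bvadd (bvadd x z) y.
Proof. by apply/ffunP => k; rewrite !ffunE addbAC. Qed.

Lemma bvaddK n (y : bv n) : involutive (fun x => bvadd x y).
Proof. by move=> x; apply/ffunP => k; rewrite !ffunE -addbA addbb addbF. Qed.

(** The change is [1 - 2 * y k], written additively to avoid truncated subtraction. *)
Lemma ell_flip n (y : bv n) k :
  (ell (bvadd y (unit_bv k)) + 2 * y k = ell y + 1)%N.
Proof.
rewrite /ell (bigD1 k) //= [X in _ = (X + _)%N](bigD1 k) //=.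
rewrite !ffunE eqxx addbT.
rewrite (eq_bigr (fun i => y i : nat)) => [|i /negPf nik]; last by rewrite !ffunE nik addbF.
by case: (y k) => /=; lia.
Qed.

Definition support_set n (s : seq ('I_n * 'I_n)) : {set 'I_n} :=
  [set k in map fst s ++ map snd s].

Lemma card_support_set n (s : seq ('I_n * 'I_n)) :
  (#|support_set s| <= 2 * size s)%N.
Proof.
by rewrite cardsE (leq_trans (card_size _)) // size_cat !size_map addnn mul2n.
Qed.

Lemma prod_transv_out n (s : seq ('I_n * 'I_n)) k (x : bv n) :
  k \notin support_set s -> prod_transv s x k = x k.
Proof.
elim: s x => [//|[i j] s IH] x; rewrite inE /= inE mem_cat inE !negb_or.
move=> /and4P[ki ks _ ks']; rewrite ffunE (negPf ki) IH //.
by rewrite inE mem_cat negb_or ks.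
Qed.

Lemma prod_transv_flip n (s : seq ('I_n * 'I_n)) k (x : bv n) :
  k \notin support_set s ->
  prod_transv s (bvadd x (unit_bv k)) = bvadd (prod_transv s x) (unit_bv k).
Proof.
elim: s x => [//|[i j] s IH] x; rewrite inE /= inE mem_cat inE !negb_or.
move=> /and4P[ki ks kj ks']; rewrite IH; last by rewrite inE mem_cat negb_or ks.
apply/ffunP => l; rewrite !ffunE; case: eqP => [->|//].
by rewrite !(eq_sym _ k) (negPf ki) (negPf kj) !addbF.
Qed.

Definition transv_fun {n t} (p : t.-tuple ('I_n * 'I_n) * bv n) (x : bv n) : nat :=
  ell (bvadd (prod_transv p.1 x) p.2).

Lemma transv_fun_flip n t (p : t.-tuple ('I_n * 'I_n) * bv n) k x :
  k \notin support_set p.1 ->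
  (transv_fun p (bvadd x (unit_bv k)) + 2 * (x k (+) p.2 k)
   = transv_fun p x + 1)%N.
Proof.
move=> kp; rewrite /transv_fun prod_transv_flip // bvaddAC -(ell_flip _ k).
by rewrite !ffunE prod_transv_out.
Qed.

(** * Density of disagreements *)

(** Flip the coordinates where [x] and [y] differ one at a time, by induction on their number. *)
Lemma flip_invariant n (S : {set 'I_n}) (Q : bv n -> bool) :
  (forall k x, k \notin S -> Q (bvadd x (unit_bv k)) = Q x) ->
  forall x y : bv n, {in S, x =1 y} -> Q x = Q y.
Proof.
move=> inv x y; have [m] := ubnP #|[set k | x k != y k]|.
elim: m x => // m IH x lt_m eqS.
have [/setP D0|[k]] := set_0Vmem [set k | x k != y k].
  by congr Q; apply/ffunP => k; have := D0 k; rewrite !inE => /negbFE/eqP.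
rewrite inE => nek; have kS : k \notin S by apply: contra nek => /eqS ->.
rewrite -(inv k x kS); apply: IH => [|i iS]; last first.
  have /negPf nik : i != k by apply: contraNneq kS => <-.
  by rewrite !ffunE nik addbF eqS.
apply: leq_trans (proper_card _) lt_m; apply/properP; split; last first.
  by exists k; rewrite !inE // !ffunE eqxx addbT negbK; case: (x k) (y k) nek => [] [].
apply/subsetP => i; rewrite !inE !ffunE; have [-> //|_] := eqVneq i k.
by rewrite addbF.
Qed.

(** A point is recovered from its restriction to [S] and its copy overwritten by [x0] on [S]; that
    copy satisfies [Q] because it agrees with [x0] there. *)
Lemma card_junta n (S : {set 'I_n}) (Q : pred (bv n)) (x0 : bv n) :
  (forall k x, k \notin S -> Q (bvadd x (unit_bv k)) = Q x) -> Q x0 ->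
  (#|{: bv n}| <= 2 ^ #|S| * #|[set x | Q x]|)%N.
Proof.
move=> inv Qx0.
pose proj (x : bv n) : bv n := [ffun k => if k \in S then x0 k else x k].
pose code (x : bv n) := ([set k in S | x k], proj x).
have inj : injective code.
  move=> x y [] /setP eqS /ffunP eqN; apply/ffunP => k.
  by have := eqS k; have := eqN k; rewrite !inE !ffunE; case: (k \in S).
rewrite -card_powerset -cardsX -cardsT -(card_imset _ inj).
apply/subset_leq_card/subsetP => _ /imsetP[x _ ->].
rewrite !inE /=; apply/andP; split.
  by apply/subsetP => k; rewrite inE => /andP[].
by rewrite (flip_invariant inv (y := x0)) // => k kS; rewrite ffunE kS.
Qed.

Lemma transv_fun_disagreements n t (p q : t.-tuple ('I_n * 'I_n) * bv n) x :
  (0 < t)%N -> transv_fun p x != transv_fun q x ->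
  (#|{: bv n}| <= 2 ^ (4 * t) * #|disagreement transv_fun p q|)%N.
Proof.
move=> t_gt0 neq; set S := support_set p.1 :|: support_set q.1.
have le_S : (#|S| <= 4 * t)%N.
  have := card_support_set p.1; have := card_support_set q.1.
  by rewrite !size_tuple => ? ?; apply: leq_trans (leq_card_setU _ _) _; lia.
(* With equal offsets outside [S], a flip there shifts both values equally, so the disagreement set
   depends only on the coordinates in [S]. *)
have [same|] := boolP [forall k in ~: S, p.2 k == q.2 k].
  have inv k y : k \notin S -> (transv_fun p (bvadd y (unit_bv k)) !=
      transv_fun q (bvadd y (unit_bv k))) = (transv_fun p y != transv_fun q y).
    move=> kS; have := forall_inP same k; rewrite inE kS => /(_ isT)/eqP pq.
    move: kS; rewrite inE negb_or => /andP[kp kq].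
    have := transv_fun_flip y kp; have := transv_fun_flip y kq.
    by rewrite pq; lia.
  by rewrite (leq_trans (card_junta inv neq)) // leq_mul // leq_pexp2l.
(* Otherwise flipping [k] moves two equal values in opposite directions, so it injects the
   complement of [D] into [D], and [D] fills at least half the cube. *)
rewrite negb_forall_in => /exists_inP[k]; rewrite inE => kS npq.
set D := disagreement _ _ _.
have sub : (fun y => bvadd y (unit_bv k)) @: (~: D) \subset D.
  apply/subsetP => _ /imsetP[y yD ->].
  move: kS; rewrite in_setU negb_or => /andP[kp kq].
  move: yD; rewrite !inE negbK => /eqP eqy.
  have := transv_fun_flip y kp; have := transv_fun_flip y kq; rewrite eqy.
  by move: npq; case: (p.2 k) (q.2 k) (y k) => [] [] [] //= _; lia.
have := subset_leq_card sub; rewrite card_imset; last exact: inv_inj (@bvaddK n _).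
have := cardsC D.
have two_le : (2 <= 2 ^ (4 * t))%N by rewrite -[X in (X <= _)%N]expn1 leq_pexp2l //; lia.
move=> <- le_CD; apply: leq_trans (leq_mul two_le (leqnn _)).
by rewrite mul2n -addnn leq_add2l.
Qed.

Lemma card_transv_fun_params n t : (0 < n)%N ->
  (#|{: t.-tuple ('I_n * 'I_n) * bv n}| <= 2 ^ ((2 * t + 1) * n))%N.
Proof.
move=> n_gt0; rewrite card_prod card_tuple card_prod card_ord card_ffun card_bool card_ord.
rewrite mulnDl mul1n expnD leq_mul // mulnn -expnM (mulnC _ n) (expnM 2 n).
by rewrite leq_expn2r // ltnW // ltn_expl.
Qed.

(** Here [K = 2 ^ (4 * t)], and [L = (4 * t + 3) * n] strictly exceeds the exponent
    [(4 * t + 2) * n] bounding the number of pairs. *)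
Lemma transv_fun_separating_points n t : (0 < n)%N -> (0 < t)%N ->
  exists2 xs : seq (bv n), size xs = (2 ^ (4 * t) * ((4 * t + 3) * n))%N &
    forall p q : t.-tuple ('I_n * 'I_n) * bv n,
      {in xs, transv_fun p =1 transv_fun q} -> transv_fun p =1 transv_fun q.
Proof.
move=> n_gt0 t_gt0; apply: separating_points.
- by move=> p q x; apply: transv_fun_disagreements.
- exact: [ffun => false].
- by rewrite expn_gt0.
- apply: leq_ltn_trans (_ : _ <= (2 ^ ((2 * t + 1) * n)) ^ 2)%N _.
    by rewrite leq_expn2r // card_transv_fun_params.
  by rewrite -expnM ltn_exp2l //; nia.
Qed.

(** * Running time of deterministic algorithms *)

Section Deterministic.
Variables (R : realType) (n : nat) (next : seq (bv n * R) -> bv n).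

Let query_det (h : seq (bv n * R)) (x : bv n) : R := (x == next h)%:R.

Lemma query_det_ge0 h x : 0 <= query_det h x.
Proof. exact: ler0n. Qed.

Lemma query_det_sum1 h : \sum_(x : bv n) query_det h x = 1.
Proof.
rewrite (bigD1 (next h)) //= /query_det eqxx big1 ?addr0 // => x.
by move=> /negPf ->.
Qed.

Definition deterministic := BBAlg query_det_ge0 query_det_sum1.

Variable f : bv n -> R.

Definition extend_history h := rcons h (next h, f (next h)).

(** A point mass keeps one term of each sum, so the probability is the indicator that the single
    forced run misses. *)
Lemma avoid_deterministic k h : avoid deterministic f k h =
  (all (fun h' => ~~ is_maximizer f (next h')) (traject extend_history h k))%:R.
Proof.
elim: k h => [//|k IH] h /=; under eq_bigr => x _ do rewrite IH.
have [hmax|hN] := boolP (is_maximizer f (next h)); last first.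
  rewrite (bigD1 (next h)) //= /query_det eqxx mul1r big1 ?addr0 // => x /andP[_ /negPf ->].
  by rewrite mul0r.
rewrite big1 // => x xN; rewrite /query_det; case: eqP xN => [->|_ _].
  by rewrite hmax.
by rewrite mul0r.
Qed.

Lemma runtime_deterministic m :
  is_maximizer f (next (iter m extend_history [::])) ->
  expected_runtime_le deterministic f m.+1%:R.
Proof.
move=> hit K; under eq_bigr => k _ do rewrite avoid_deterministic.
rewrite -natr_sum ler_nat.
(* Query number [m + 1] hits, so only the terms with [k <= m] can be nonzero. *)
apply: leq_trans (_ : \sum_(k < K) (k <= m)%N <= _)%N.
  apply: leq_sum => k _; case: (leqP k m) => [_|lt_mk]; first exact: leq_b1.
  rewrite leqn0 eqb0; apply/allPn; exists (iter m extend_history [::]); last by rewrite negbK.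
  by apply/trajectP; exists m.
rewrite -(big_mkord xpredT (fun k => (k <= m) : nat)).
elim: K => [|K IH]; first by rewrite big_geq.
rewrite big_nat_recr //=; case: (leqP K m) => [le_Km|_]; last by rewrite addn0.
rewrite addn1 ltnS (leq_trans _ le_Km) //.
by rewrite -[X in (_ <= X)%N](subn0 K) -[X in (_ <= X)%N]muln1 -sum_nat_const_nat leq_sum // => i _; apply: leq_b1.
Qed.

End Deterministic.
Arguments deterministic {R n}.

(** * Search by querying separating points *)

Section SeparatingSearch.
Variables (R : realType) (n : nat) (P : finType) (F : P -> bv n -> nat).
Variable xs : seq (bv n).
Hypothesis xs_sep : forall p q, {in xs, F p =1 F q} -> F p =1 F q.

Let x0 : bv n := [ffun => false].

(** Any parameter consistent with the answers will do, since separation makes all of them define the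
    same function. The final [x0] is reached only when none is consistent. *)
Definition learn_next (h : seq (bv n * R)) : bv n :=
  if (size h < size xs)%N then nth x0 xs (size h) else
  if [pick p | all (fun c => (F p c.1)%:R == c.2) h] is Some p
  then [arg max_(x > x0) F p x]%N else x0.

Lemma learn_history f m : (m <= size xs)%N ->
  iter m (extend_history learn_next f) [::] = [seq (x, f x) | x <- take m xs].
Proof.
elim: m => [|m IH] lt_m; first by rewrite take0.
rewrite iterS IH ?(ltnW lt_m) // /extend_history /learn_next size_map.
by rewrite size_takel ?(ltnW lt_m) // lt_m (take_nth x0) // map_rcons.
Qed.

Lemma runtime_learn p f : (forall x, f x = (F p x)%:R) ->
  expected_runtime_le (deterministic learn_next) f (size xs).+1%:R.
Proof.
move=> fE; apply: runtime_deterministic.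
rewrite learn_history // take_size /learn_next size_map ltnn.
case: pickP => [q|/(_ p)]; last first.
  by rewrite all_map (introT allP) // => x _ /=; rewrite fE.
rewrite all_map => /allP eq_xs.
have eqF : F q =1 F p.
  by apply: xs_sep => x /eq_xs /=; rewrite fE eqr_nat => /eqP.
apply/forallP => y; rewrite !fE ler_nat -!eqF.
by case: arg_maxnP => // x _; apply.
Qed.

End SeparatingSearch.

(** * Comparison with the claimed bound *)

Lemma le_bound_t (R : realType) t n : (0 < t)%N -> (0 < n)%N -> expR 1 <= n%:R :> R ->
  n%:R <= bound_t R t n.
Proof.
move=> t_gt0 n_gt0 le_en; rewrite /bound_t; case: ifP => _.
  by rewrite ler_eXnr ?ler1n //; lia.
have ln_ge1 : 1 <= ln (n%:R : R).
  by rewrite -[leLHS]expRK ler_ln ?posrE ?expR_gt0 ?ltr0n.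
rewrite -[X in X <= _]mulr1 ler_pM ?ler0n ?ler01 ?exprn_ege1 //.
by rewrite ler_eXnr // ler1n.
Qed.

(* B_{F_t} = O(bound_t t n): there are C > 0 and N such that for all n >= N
   some algorithm A has sup_{f in F_t} E(T(A,f)) <= C * bound_t t n. *)
Theorem theorem6 (R : realType) (t : nat) : (0 < t)%N ->
  exists C : R, 0 < C /\
  exists N : nat, forall n : nat, (N <= n)%N ->
    exists A : bb_algorithm R n,
      forall f : bv n -> R, in_F t f ->
        expected_runtime_le A f (C * bound_t R t n).
Proof.
(* The summand [1] in [c] pays for the final query, as [n >= 1]. *)
move=> t_gt0; pose c := (2 ^ (4 * t) * (4 * t + 3) + 1)%N.
exists c%:R; split; first by rewrite ltr0n /c addn1.
(* Beyond this threshold [n] exceeds [e], hence [ln n >= 1]. *)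
exists (Num.Def.archi_bound (expR 1 : R)) => n le_Nn.
have lt_en : expR 1 < n%:R :> R.
  by apply: lt_le_trans (archi_boundP (expR_ge0 _)) _; rewrite ler_nat.
have n_gt0 : (0 < n)%N by rewrite -(ltr0n R) (lt_trans (expR_gt0 1)).
have [xs sz_xs xs_sep] := transv_fun_separating_points n_gt0 t_gt0.
exists (deterministic (learn_next (@transv_fun n t) xs)).
move=> f [M [b [[s [sz_s _ eqM]] fE]]] K.
have sz : size s == t by apply/eqP.
apply: le_trans (runtime_learn xs_sep (p := (Tuple sz, b)) _ K) _.
  by move=> x; rewrite fE eqM.
apply: le_trans (_ : c%:R * n%:R <= _).
  by rewrite -natrM ler_nat sz_xs /c; nia.
by rewrite ler_wpM2l ?ler0n // le_bound_t // ltW.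
Qed.
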